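(* Let $n\ge1$ and $1\le a\le n+1$ be integers (corresponding to $X=\mathbb P^n$ and $\mathcal L=\mathcal O(a)$). In the ring $\mathbb D'=\mathbb C[q^{\pm1},z]\langle z\delta_q\rangle$, let $\mathbb G'=\langle\square_h\rangle$ be the left ideal generated by $$\square_h=(z\delta_q)^{n+1}-q\prod_{\nu=1}^{a}(a\,z\delta_q+\nu z),$$ and let $\widehat c_{\mathrm{top}}=a\,z\delta_q$. Then $$(\mathbb G':\widehat c_{\mathrm{top}})=\Bigl\langle\square_h,\ \tfrac1a(z\delta_q)^n-q\,(a\,z\delta_q+z)\cdots(a\,z\delta_q+(a-1)z)\Bigr\rangle.$$
   Context: $\delta_q=q\partial_q$; $\mathbb D'$ is the non-commutative algebra generated over $\mathbb C$ by $q^{\pm1},z$ and $z\delta_q$, with $z$ central and $(z\delta_q)q=q(z\delta_q)+zq$. $\langle\cdot\rangle$ denotes the left ideal generated. For a left ideal $\mathbb G'$ of $\mathbb D'$, $(\mathbb G':\widehat c_{\mathrm{top}})$ is the left ideal of $\mathbb D'$ generated by $\{P\in\mathbb D'\mid\widehat c_{\mathrm{top}}P\in\mathbb G'\}$. For $a=1$ the product $(a\,z\delta_q+z)\cdots(a\,z\delta_q+(a-1)z)$ is empty and equals $1$. ($\mathbb G'$ is the GKZ ideal, with the Euler operator eliminated, attached to $\mathbb P^n$ and $\mathcal O(a)$, where $h$ is the class of a line.) *)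

(* Defs.v *)
From HB Require Import structures.
From mathcomp Require Import all_boot all_order all_algebra.
From mathcomp Require Import boolp classical_sets reals.
From mathcomp Require Export complex.
Set Implicit Arguments.
Unset Strict Implicit.
Unset Printing Implicit Defensive.
Import GRing.Theory.
Local Open Scope ring_scope.
Local Open Scope classical_set_scope.
Local Open Scope quotient_scope.

(* D' is the unital associative K-algebra presented by the generators q, q^-1,
   z, z delta_q and the relations in the last four clauses of [dcong]: it is the
   type [dterm] of noncommutative expressions modulo [dcong], the congruence
   generated by the K-algebra axioms and these relations. *)
Inductive dterm (K : Type) : Type :=
| DScal of K
| DQ | DQinv | DZ | DZdelta
| DAdd of dterm K & dterm K
| DMul of dterm K & dterm K.

Arguments DQ {K}.
Arguments DQinv {K}.
Arguments DZ {K}.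
Arguments DZdelta {K}.

HB.instance Definition _ (K : Type) := gen_eqMixin (dterm K).
HB.instance Definition _ (K : Type) := gen_choiceMixin (dterm K).

Inductive dcong (K : comNzRingType) : dterm K -> dterm K -> Prop :=
| dcong_refl x : dcong x x
| dcong_sym x y : dcong x y -> dcong y x
| dcong_trans y x u : dcong x y -> dcong y u -> dcong x u
| dcong_add x x' y y' :
    dcong x x' -> dcong y y' -> dcong (DAdd x y) (DAdd x' y')
| dcong_mul x x' y y' :
    dcong x x' -> dcong y y' -> dcong (DMul x y) (DMul x' y')
| dcong_addA x y u : dcong (DAdd x (DAdd y u)) (DAdd (DAdd x y) u)
| dcong_addC x y : dcong (DAdd x y) (DAdd y x)
| dcong_add0 x : dcong (DAdd (DScal 0) x) x
| dcong_mulA x y u : dcong (DMul x (DMul y u)) (DMul (DMul x y) u)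
| dcong_mul1 x : dcong (DMul (DScal 1) x) x
| dcong_mul0 x : dcong (DMul (DScal 0) x) (DScal 0)
| dcong_mulDl x y u : dcong (DMul (DAdd x y) u) (DAdd (DMul x u) (DMul y u))
| dcong_mulDr x y u : dcong (DMul x (DAdd y u)) (DAdd (DMul x y) (DMul x u))
| dcong_scalD c d : dcong (DScal (c + d)) (DAdd (DScal c) (DScal d))
| dcong_scalM c d : dcong (DScal (c * d)) (DMul (DScal c) (DScal d))
| dcong_scalC c x : dcong (DMul (DScal c) x) (DMul x (DScal c))
| dcong_qqinv : dcong (DMul DQ DQinv) (DScal 1)
| dcong_qinvq : dcong (DMul DQinv DQ) (DScal 1)
| dcong_zC x : dcong (DMul DZ x) (DMul x DZ)
| dcong_zdelta_q :
    dcong (DMul DZdelta DQ) (DAdd (DMul DQ DZdelta) (DMul DZ DQ)).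

Section Evaluation.
Variables (K : comNzRingType) (A : algType K) (q qinv z t : A).

Fixpoint deval (x : dterm K) : A :=
  match x with
  | DScal c => c%:A
  | DQ => q
  | DQinv => qinv
  | DZ => z
  | DZdelta => t
  | DAdd u v => deval u + deval v
  | DMul u v => deval u * deval v
  end.

Hypotheses (qqinv : q * qinv = 1) (qinvq : qinv * q = 1).
Hypotheses (zq : z * q = q * z) (zt : z * t = t * z).
Hypothesis tq : t * q = q * t + z * q.

Lemma deval_zC x : z * deval x = deval x * z.
Proof.
elim: x => [c|||||u IHu v IHv|u IHu v IHv] //=.
- by rewrite -scalerAr mulr1 -scalerAl mul1r.
- have E : qinv * (q * z) * qinv = z * qinv by rewrite mulrA qinvq mul1r.
  by rewrite -E -zq mulrA -!mulrA qqinv mulr1.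
- by rewrite mulrDr mulrDl IHu IHv.
- by rewrite mulrA IHu -mulrA IHv mulrA.
Qed.

Lemma deval_cong x y : dcong x y -> deval x = deval y.
Proof.
elim=> {x y} //=.
- by move=> y x u _ -> _ ->.
- by move=> x x' y y' _ -> _ ->.
- by move=> x x' y y' _ -> _ ->.
- by move=> x y u; rewrite addrA.
- by move=> x y; rewrite addrC.
- by move=> x; rewrite scale0r add0r.
- by move=> x y u; rewrite mulrA.
- by move=> x; rewrite scale1r mul1r.
- by move=> x; rewrite scale0r mul0r.
- by move=> x y u; rewrite mulrDl.
- by move=> x y u; rewrite mulrDr.
- by move=> c d; rewrite scalerDl.
- by move=> c d; rewrite -scalerAl mul1r scalerA.
- by move=> c x; rewrite -scalerAr mulr1 -scalerAl mul1r.
- by rewrite scale1r.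
- by rewrite scale1r.
- exact: deval_zC.
Qed.

End Evaluation.

Section Quotient.
Variable K : comNzRingType.

Definition dcongb : rel (dterm K) := fun x y => `[< dcong x y >].

Lemma dcongb_equiv : equiv_class_of dcongb.
Proof.
split=> [x|x y|y x u].
- by apply/asboolP; exact: dcong_refl.
- by apply/asboolP/asboolP; exact: dcong_sym.
- by move=> /asboolP xy /asboolP yu; apply/asboolP; exact: dcong_trans yu.
Qed.

Canonical dcongb_rel := EquivRelPack dcongb_equiv.

Definition Dprime := {eq_quot dcongb}.
HB.instance Definition _ : EqQuotient _ dcongb Dprime := EqQuotient.on Dprime.
HB.instance Definition _ := Choice.on Dprime.

Lemma dpiP (x y : dterm K) : dcong x y -> \pi_Dprime x = \pi_Dprime y.
Proof. by move=> xy; apply/eqquotP/asboolP. Qed.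

Lemma drepr (x : dterm K) : dcong (repr (\pi_Dprime x)) x.
Proof. by apply/asboolP; have /eqquotP := reprK (\pi_Dprime x). Qed.

Definition dscal (c : K) : Dprime := \pi_Dprime (DScal c).
Definition dadd (x y : Dprime) : Dprime := \pi_Dprime (DAdd (repr x) (repr y)).
Definition dmul (x y : Dprime) : Dprime := \pi_Dprime (DMul (repr x) (repr y)).
Definition dopp (x : Dprime) : Dprime := dmul (dscal (-1)) x.
Definition dscale (c : K) (x : Dprime) : Dprime := dmul (dscal c) x.

Lemma dadd_pi x y : dadd (\pi x) (\pi y) = \pi_Dprime (DAdd x y).
Proof. by apply: dpiP; apply: dcong_add; exact: drepr. Qed.

Lemma dmul_pi x y : dmul (\pi x) (\pi y) = \pi_Dprime (DMul x y).
Proof. by apply: dpiP; apply: dcong_mul; exact: drepr. Qed.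

Lemma daddA : associative dadd.
Proof.
elim/quotW=> x; elim/quotW=> y; elim/quotW=> u.
by rewrite !dadd_pi; apply: dpiP; exact: dcong_addA.
Qed.

Lemma daddC : commutative dadd.
Proof.
elim/quotW=> x; elim/quotW=> y.
by rewrite !dadd_pi; apply: dpiP; exact: dcong_addC.
Qed.

Lemma dadd0 : left_id (dscal 0) dadd.
Proof. by elim/quotW=> x; rewrite dadd_pi; apply: dpiP; exact: dcong_add0. Qed.

Lemma dmulA : associative dmul.
Proof.
elim/quotW=> x; elim/quotW=> y; elim/quotW=> u.
by rewrite !dmul_pi; apply: dpiP; exact: dcong_mulA.
Qed.

Lemma dmul1 : left_id (dscal 1) dmul.
Proof. by elim/quotW=> x; rewrite dmul_pi; apply: dpiP; exact: dcong_mul1. Qed.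

Lemma dscalC c x : dmul (dscal c) x = dmul x (dscal c).
Proof.
by elim/quotW: x => x; rewrite !dmul_pi; apply: dpiP; exact: dcong_scalC.
Qed.

Lemma dmulr1 : right_id (dscal 1) dmul.
Proof. by move=> x; rewrite -dscalC dmul1. Qed.

Lemma dmulDl : left_distributive dmul dadd.
Proof.
elim/quotW=> x; elim/quotW=> y; elim/quotW=> u.
by rewrite !(dmul_pi, dadd_pi); apply: dpiP; exact: dcong_mulDl.
Qed.

Lemma dmulDr : right_distributive dmul dadd.
Proof.
elim/quotW=> x; elim/quotW=> y; elim/quotW=> u.
by rewrite !(dmul_pi, dadd_pi); apply: dpiP; exact: dcong_mulDr.
Qed.

Lemma dmul0 x : dmul (dscal 0) x = dscal 0.
Proof. by elim/quotW: x => x; rewrite dmul_pi; apply: dpiP; exact: dcong_mul0. Qed.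

Lemma dscalD c d : dscal (c + d) = dadd (dscal c) (dscal d).
Proof. by rewrite dadd_pi; apply: dpiP; exact: dcong_scalD. Qed.

Lemma dscalM c d : dscal (c * d) = dmul (dscal c) (dscal d).
Proof. by rewrite dmul_pi; apply: dpiP; exact: dcong_scalM. Qed.

Lemma daddN : left_inverse (dscal 0) dopp dadd.
Proof.
by move=> x; rewrite -{2}(dmul1 x) -dmulDl -dscalD addNr dmul0.
Qed.

HB.instance Definition _ :=
  GRing.isZmodule.Build Dprime daddA daddC dadd0 daddN.

Lemma done_neq0 : dscal 1 != 0 :> Dprime.
Proof.
apply/eqP => /eqquotP/asboolP E; have /eqP := oner_neq0 K; case.
have := @deval_cong K K^o 1 1 0 0.
move=> /(_ (mulr1 _) (mulr1 _) (etrans (mul0r _) (esym (mulr0 _))) erefl).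
by rewrite !mulr0 !mul0r addr0 => /(_ erefl _ _ E) /=; rewrite scale1r scale0r.
Qed.

HB.instance Definition _ := GRing.Zmodule_isNzRing.Build Dprime
  dmulA dmul1 dmulr1 dmulDl dmulDr done_neq0.

Lemma dscaleA c d (x : Dprime) : dscale c (dscale d x) = dscale (c * d) x.
Proof. by rewrite /dscale dscalM dmulA. Qed.

Lemma dscale1 : left_id 1 dscale.
Proof. exact: dmul1. Qed.

Lemma dscaleDr : right_distributive dscale +%R.
Proof. by move=> c x y; exact: dmulDr. Qed.

Lemma dscaleDl (x : Dprime) : {morph dscale^~ x : c d / c + d}.
Proof. by move=> c d; rewrite /dscale dscalD; exact: dmulDl. Qed.

HB.instance Definition _ := GRing.Zmodule_isLmodule.Build K Dprime
  dscaleA dscale1 dscaleDr dscaleDl.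

Lemma dscaleAl (c : K) (x y : Dprime) : c *: (x * y) = (c *: x) * y.
Proof. exact: dmulA. Qed.

HB.instance Definition _ := GRing.Lmodule_isLalgebra.Build K Dprime dscaleAl.

Lemma dscaleAr (c : K) (x y : Dprime) : c *: (x * y) = x * (c *: y).
Proof.
have E u : c *: u = dscal c * u :> Dprime by [].
have C : dscal c * x = x * dscal c by exact: dscalC.
by rewrite !E mulrA C mulrA.
Qed.

HB.instance Definition _ := GRing.Lalgebra_isAlgebra.Build K Dprime dscaleAr.

Definition Dq : Dprime := \pi_Dprime DQ.
Definition Dqinv : Dprime := \pi_Dprime DQinv.
Definition Dz : Dprime := \pi_Dprime DZ.
Definition Dzdelta : Dprime := \pi_Dprime DZdelta.

Lemma Dq_qinv : Dq * Dqinv = 1.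
Proof. by rewrite [LHS]dmul_pi; apply: dpiP; exact: dcong_qqinv. Qed.

Lemma Dqinv_q : Dqinv * Dq = 1.
Proof. by rewrite [LHS]dmul_pi; apply: dpiP; exact: dcong_qinvq. Qed.

Lemma Dz_central (x : Dprime) : Dz * x = x * Dz.
Proof.
elim/quotW: x => x; rewrite [LHS]dmul_pi [RHS]dmul_pi.
by apply: dpiP; exact: dcong_zC.
Qed.

Lemma Dzdelta_q : Dzdelta * Dq = Dq * Dzdelta + Dz * Dq.
Proof.
rewrite [LHS]dmul_pi; apply: etrans (dpiP (dcong_zdelta_q K)) _.
by rewrite -dadd_pi -!dmul_pi.
Qed.

End Quotient.

Arguments Dq {K}.
Arguments Dqinv {K}.
Arguments Dz {K}.
Arguments Dzdelta {K}.

Definition is_left_ideal (D : nzRingType) (I : set D) : Prop :=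
  [/\ I 0, (forall x y, I x -> I y -> I (x + y))
    & (forall a x, I x -> I (a * x))].

Definition left_ideal_gen (D : nzRingType) (S : set D) : set D :=
  [set x | forall I, is_left_ideal I -> S `<=` I -> I x].

(* The set [set P | c * P \in G] need not be a left ideal: D' is not
   commutative. *)
Definition left_colon (D : nzRingType) (G : set D) (c : D) : set D :=
  left_ideal_gen [set P | G (c * P)].

Definition square_h (K : comNzRingType) (n a : nat) : Dprime K :=
  Dzdelta ^+ n.+1
  - Dq * \prod_(1 <= nu < a.+1) (a%:R *: Dzdelta + nu%:R *: Dz).

Definition c_top (K : comNzRingType) (a : nat) : Dprime K := a%:R *: Dzdelta.

Definition reduced_op (K : fieldType) (n a : nat) : Dprime K :=
  a%:R^-1 *: Dzdelta ^+ n
  - Dq * \prod_(1 <= nu < a) (a%:R *: Dzdelta + nu%:R *: Dz).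

(* Main.v *)
(* Write t for z delta_q and rho for the second generator of the right-hand
   side.  From t q = q (t + z) one gets c_top rho = square_h, so the right-hand
   side is D' rho and the claim is that t P in D' rho forces P in D' rho.  Every
   element of D' is uniquely a finite sum of q^k p_k(t, z), and it lies in t D'
   iff (t + k z) | p_k for all k.  If t P = S rho, with S = sum_k q^k s_k, then
   setting t = - k z in the coefficient of q^k gives, for
   sigma_k = s_k(- k z, z),
     (1/a) (- k z)^n sigma_k = prod_(0 < nu < a) ((nu - a k) z) sigma_(k-1).
   The product is never 0, and sigma_k = 0 for large k, so all sigma_k vanish by
   descending induction: S = t S', and cancelling t gives P = S' rho. *)
Require Import Defs.
From mathcomp Require Import all_boot all_order all_algebra.
From mathcomp Require Import boolp classical_sets reals.
From mathcomp Require Import zify.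
Import GRing.Theory Num.Theory.
Local Open Scope ring_scope.
Local Open Scope classical_set_scope.
Local Open Scope quotient_scope.

Set Implicit Arguments.
Unset Strict Implicit.
Unset Printing Implicit Defensive.

(** * The left action of D' on families of coefficients *)

Section Coefficients.
Variable K : comNzRingType.
Notation T := {poly {poly K}}.
Implicit Types (x y : dterm K) (f g : int -> T) (p : T) (k : int).
Implicit Types A B : Dprime K.

(** This is t + k z, the outer variable being t and the inner one z; it comes from t q^k = q^k (t +
    k z). *)
Definition shift_zdelta k : T := 'X + (k%:~R * 'X)%:P.

(** A family [f] stands for the formal sum of the q^k f_k(t, z), on which expressions act by left
    multiplication. Infinite families are allowed, so no supports have to be tracked. *)
Fixpoint dact x f : int -> T :=
  match x with
  | DScal c => fun k => c%:P%:P * f k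
  | DQ => fun k => f (k - 1)
  | DQinv => fun k => f (k + 1)
  | DZ => fun k => 'X%:P * f k
  | DZdelta => fun k => shift_zdelta k * f k
  | DAdd u v => fun k => dact u f k + dact v f k
  | DMul u v => dact u (dact v f)
  end.

(** Multiplying all coefficients by [p] is right multiplication by p(t, z), which commutes with the
    left action. The combined form yields additivity and linearity from one induction. *)
Lemma dactP x p f g :
  dact x (fun k => p * f k + g k) = (fun k => p * dact x f k + dact x g k).
Proof.
elim: x f g => [c|||||u IHu v IHv|u IHu v IHv] f g //=.
- by apply/funext => k; rewrite mulrDr mulrCA.
- by apply/funext => k; rewrite mulrDr mulrCA.
- by apply/funext => k; rewrite mulrDr mulrCA.
- by apply/funext => k; rewrite IHu IHv mulrDr addrACA.
- by rewrite IHv IHu.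
Qed.

Lemma dactD x f g : dact x (fun k => f k + g k) = (fun k => dact x f k + dact x g k).
Proof.
have E : (fun k => f k + g k) = (fun k => 1 * f k + g k).
  by apply/funext => k; rewrite mul1r.
by rewrite E dactP; apply/funext => k; rewrite mul1r.
Qed.

Lemma dact0 x : dact x (fun=> 0) = (fun=> 0).
Proof.
apply/funext => k; have := congr1 (@^~ k) (dactP x (-1) (fun=> 0) (fun=> 0)).
by rewrite /= mulr0 addr0 mulN1r addNr.
Qed.

Lemma dactM x p f : dact x (fun k => p * f k) = (fun k => p * dact x f k).
Proof.
have E : (fun k => p * f k) = (fun k => p * f k + (fun=> 0) k).
  by apply/funext => k; rewrite addr0.
by rewrite E dactP dact0; apply/funext => k; rewrite addr0.
Qed.

Lemma dact_cong x y : dcong x y -> dact x = dact y.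
Proof.
elim=> {x y} //=.
- by move=> x y u _ -> _ ->.
- by move=> x x' y y' _ E1 _ E2; apply/funext => f; rewrite E1 E2.
- by move=> x x' y y' _ E1 _ E2; apply/funext => f; rewrite E1 E2.
- by move=> x y u; apply/funext => f; apply/funext => k; rewrite addrA.
- by move=> x y; apply/funext => f; apply/funext => k; rewrite addrC.
- by move=> x; apply/funext => f; apply/funext => k; rewrite mul0r add0r.
- by move=> x; apply/funext => f; apply/funext => k; rewrite mul1r.
- by move=> x; apply/funext => f; apply/funext => k; rewrite !mul0r.
- by move=> x y u; apply/funext => f; rewrite dactD.
- by move=> c d; apply/funext => f; apply/funext => k; rewrite !polyCD mulrDl.
- by move=> c d; apply/funext => f; apply/funext => k; rewrite !polyCM mulrA.
- by move=> c x; apply/funext => f; rewrite dactM.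
- by apply/funext => f; apply/funext => k; rewrite mul1r subrK.
- by apply/funext => f; apply/funext => k; rewrite mul1r addrK.
- by move=> x; apply/funext => f; rewrite dactM.
(* The relation t q = q t + z q amounts to t + k z = (t + (k - 1) z) + z. *)
- apply/funext => f; apply/funext => k; rewrite -mulrDl; congr (_ * _).
  rewrite /shift_zdelta -addrA -polyCD; congr (_ + _%:P).
  by rewrite intrB mulrBl mul1r subrK.
Qed.

Definition act A : (int -> T) -> int -> T := dact (repr A).

Lemma act_pi x : act (\pi_(Dprime K) x) = dact x.
Proof. exact: dact_cong (drepr x). Qed.

Definition one_coef k : T := (k == 0)%:R.

(* [qcoef A k] is the polynomial [p_k] of the normal form
   [A = \sum_k q^k * p_k(z delta_q)], the inner variable standing for [z]. *)
Definition qcoef A : int -> T := act A one_coef.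

Lemma actM A B f : act (A * B) f = act A (act B f).
Proof. by rewrite act_pi. Qed.

Lemma actD A B f k : act (A + B) f k = act A f k + act B f k.
Proof. by rewrite act_pi. Qed.

Lemma qcoefM A B : qcoef (A * B) = act A (qcoef B).
Proof. exact: actM. Qed.

Lemma qcoefD A B k : qcoef (A + B) k = qcoef A k + qcoef B k.
Proof. exact: actD. Qed.

Lemma qcoefZ c A k : qcoef (c *: A) k = c%:P%:P * qcoef A k.
Proof. by rewrite [LHS]/qcoef actM act_pi. Qed.

Lemma qcoefN A k : qcoef (- A) k = - qcoef A k.
Proof. by rewrite -scaleN1r qcoefZ !polyCN mulN1r. Qed.

Lemma qcoef1 : qcoef 1 = one_coef.
Proof. by rewrite /qcoef act_pi; apply/funext => k /=; rewrite mul1r. Qed.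

Lemma qcoefqM A k : qcoef (Dq * A) k = qcoef A (k - 1).
Proof. by rewrite qcoefM act_pi. Qed.

Lemma qcoefqinvM A k : qcoef (Dqinv * A) k = qcoef A (k + 1).
Proof. by rewrite qcoefM act_pi. Qed.

Lemma qcoefzM A k : qcoef (Dz * A) k = 'X%:P * qcoef A k.
Proof. by rewrite qcoefM act_pi. Qed.

Lemma qcoeftM A k : qcoef (Dzdelta * A) k = shift_zdelta k * qcoef A k.
Proof. by rewrite qcoefM act_pi. Qed.

Lemma qcoefMt A k : qcoef (A * Dzdelta) k = 'X * qcoef A k.
Proof.
have E : qcoef Dzdelta = fun j => 'X * one_coef j.
  rewrite /qcoef act_pi /=; apply/funext => j; rewrite /one_coef /shift_zdelta.
  by case: eqP => [->|]; rewrite ?mulr0 // mul0r addr0.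
by rewrite qcoefM E /act dactM.
Qed.

(** The left action commutes with right multiplication by q, which sends q^k p(t) to q^(k+1) p(t +
    z). *)
Lemma dact_shift x f :
  dact x (fun k => f (k - 1) \Po ('X + 'X%:P)) =
  (fun k => dact x f (k - 1) \Po ('X + 'X%:P)).
Proof.
elim: x f => [c|||||u IHu v IHv|u IHu v IHv] f //=.
- by apply/funext => k; rewrite comp_polyM comp_polyC.
- by apply/funext => k; rewrite addrAC.
- by apply/funext => k; rewrite comp_polyM comp_polyC.
- apply/funext => k; rewrite comp_polyM; congr (_ * _).
  rewrite comp_polyD comp_polyX comp_polyC /shift_zdelta -addrA -polyCD.
  by rewrite intrB mulrBl mul1r addrCA subrr addr0.
- by apply/funext => k; rewrite IHu IHv comp_polyD.
- by rewrite IHv IHu.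
Qed.

Lemma qcoefMq A k :
  qcoef (A * Dq) k = qcoef A (k - 1) \Po ('X + 'X%:P).
Proof.
have E : qcoef Dq = fun j => one_coef (j - 1) \Po ('X + 'X%:P).
  rewrite /qcoef act_pi /=; apply/funext => j; rewrite /one_coef.
  by case: eqP => _; rewrite ?comp_poly0 // comp_polyC.
by rewrite qcoefM E /act dact_shift.
Qed.

(** * Normal forms: existence and uniqueness *)

Lemma commr_zt : commr_rmorph (horner_alg (Dz : Dprime K)) Dzdelta.
Proof.
move=> p; rewrite /GRing.comm.
elim/poly_ind: p => [|p c IH]; first by rewrite rmorph0 mulr0 mul0r.
rewrite rmorphD rmorphM /= horner_algX horner_algC mulrDr mulrDl mulrA IH.
by rewrite -!mulrA Dz_central mul1r -scalerAr mulr1.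
Qed.

Definition poly_op : {rmorphism T -> Dprime K} := horner_morph commr_zt.

Definition qpow (k : int) : Dprime K :=
  match k with Posz n => Dq ^+ n | Negz n => Dqinv ^+ n.+1 end.

Lemma qpowS k : qpow (k + 1) = Dq * qpow k.
Proof.
case: k => [n|[|n]]; first by rewrite -PoszD addn1 /= exprS.
- by rewrite /= expr1 Dq_qinv expr0.
- have -> : Negz n.+1 + 1 = Negz n by rewrite !NegzE -[n.+2]addn1 PoszD opprD addrNK.
  by rewrite /= [in RHS]exprS mulrA Dq_qinv mul1r.
Qed.

Lemma qpowB k : qpow (k - 1) = Dqinv * qpow k.
Proof. by rewrite -[in RHS](subrK 1 k) qpowS mulrA Dqinv_q mul1r. Qed.

Lemma zdelta_qpow k : Dzdelta * qpow k = qpow k * poly_op (shift_zdelta k).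
Proof.
have E j : poly_op (shift_zdelta j) = Dzdelta + j%:~R * Dz.
  rewrite rmorphD /= /poly_op horner_morphX horner_morphC; congr (_ + _).
  by rewrite rmorphM /= rmorph_int horner_algX.
(* Multiplying the relation for t q by q^-1 on both sides gives the rule for negative exponents. *)
have tqinv : Dzdelta * Dqinv = Dqinv * (Dzdelta - Dz) :> Dprime K.
  apply: etrans (_ : Dqinv * (Dq * Dzdelta) * Dqinv = _).
    by rewrite mulrA Dqinv_q mul1r.
  have -> : Dq * Dzdelta = (Dzdelta - Dz) * Dq :> Dprime K.
    by rewrite mulrBl Dzdelta_q addrK.
  by rewrite -!mulrA Dq_qinv mulr1.
have zI j (A : Dprime K) : j%:~R * Dz * A = A * (j%:~R * Dz).
  by rewrite -mulrA Dz_central mulrA -commr_int mulrA.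
rewrite E; elim/int_rect: k => [|n IH|n IH].
- by rewrite /= expr0 mul0r addr0 mulr1 mul1r.
- rewrite intS addrC qpowS mulrA Dzdelta_q Dz_central -mulrDr -mulrA mulrDl IH.
  rewrite Dz_central -mulrDr -mulrA; congr (_ * (_ * _)).
  by rewrite intrD mulrDl mul1r addrA.
- rewrite intS opprD addrC qpowB mulrA tqinv -mulrA mulrBl IH.
  rewrite Dz_central -mulrBr -mulrA; congr (_ * (_ * _)).
  by rewrite intrB mulrBl mul1r addrA.
Qed.

(* Quantifying over all supersets [s'] of the support makes the property
   obviously stable under sums and shifts. *)
Definition has_normal_form A := exists s : seq int,
  (forall k, k \notin s -> qcoef A k = 0) /\
  forall s', uniq s' -> {subset s <= s'} ->
    A = \sum_(k <- s') qpow k * poly_op (qcoef A k).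

(** Treats q and q^-1 together: they translate the support by [e] = 1 and [e] = -1. *)
Lemma normal_form_shift A B (e d : int) (h : d = - e) :
  (forall k, qcoef (B * A) k = qcoef A (k + d)) ->
  (forall k, qpow (k + e) = B * qpow k) ->
  has_normal_form A -> has_normal_form (B * A).
Proof.
move=> cB qB [s [s0 sE]]; exists (map (fun k => k + e) s); split=> [k ks|s' us' ss'].
  rewrite cB s0 // h; apply: contra ks => ks; apply/mapP; exists (k - e) => //.
  by rewrite subrK.
rewrite {1}(sE (map (fun k => k - e) s')).
- rewrite mulr_sumr big_map; apply: eq_bigr => k _.
  by rewrite mulrA -qB subrK cB h.
- by rewrite map_inj_uniq //; apply: addIr.
- move=> k ks; apply/mapP; exists (k + e); rewrite ?addrK //.
  by apply: ss'; apply/mapP; exists k.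
Qed.

Lemma has_normal_formP A : has_normal_form A.
Proof.
(* Generalizing to left multiplication lets the product case of the induction treat (u v) B as u (v
   B). *)
suff H x B : has_normal_form B -> has_normal_form (\pi_(Dprime K) x * B).
  elim/quotW: A => x; rewrite -[\pi x]mulr1; apply: H.
  exists [:: 0]; rewrite qcoef1; split=> [k|s us sub].
    by rewrite inE /one_coef => /negbTE ->.
  rewrite (bigD1_seq 0) //=; last by apply: sub; rewrite inE.
  rewrite expr0 mul1r rmorph1 big1 ?addr0 // => k /negbTE nk.
  by rewrite /one_coef nk rmorph0 mulr0.
elim: x B => [c|||||u IHu v IHv|u IHu v IHv] B nB.
- have [s [s0 sE]] := nB; exists s; rewrite -[_ * B]/(c *: B).
  split=> [k /s0|s' us ss]; rewrite ?qcoefZ; first by move=> ->; rewrite mulr0.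
  rewrite {1}(sE _ us ss) scaler_sumr; apply: eq_bigr => k _.
  rewrite qcoefZ rmorphM /= scalerAr; congr (_ * _).
  by rewrite /poly_op !horner_morphC /= horner_algC -scalerAl mul1r.
- rewrite -/Dq; apply: (@normal_form_shift B Dq 1 (-1)) => // k.
    exact: qcoefqM.
  exact: qpowS.
- rewrite -/Dqinv; apply: (@normal_form_shift B Dqinv (-1) 1) => // k.
    exact: qcoefqinvM.
  exact: qpowB.
- have [s [s0 sE]] := nB; exists s; rewrite -/Dz.
  split=> [k /s0|s' us ss]; rewrite ?qcoefzM; first by move=> ->; rewrite mulr0.
  rewrite {1}(sE _ us ss) mulr_sumr; apply: eq_bigr => k _.
  rewrite qcoefzM rmorphM /= mulrA Dz_central -mulrA; congr (_ * (_ * _)).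
  by rewrite /poly_op horner_morphC /= horner_algX.
- have [s [s0 sE]] := nB; exists s; rewrite -/Dzdelta.
  split=> [k /s0|s' us ss]; rewrite ?qcoeftM; first by move=> ->; rewrite mulr0.
  rewrite {1}(sE _ us ss) mulr_sumr; apply: eq_bigr => k _.
  by rewrite qcoeftM rmorphM /= !mulrA zdelta_qpow.
- have -> : \pi_(Dprime K) (DAdd u v) = \pi_(Dprime K) u + \pi_(Dprime K) v
    :> Dprime K by rewrite [RHS]dadd_pi.
  rewrite mulrDl; have [s [s0 sE]] := IHu _ nB; have [s' [s0' sE']] := IHv _ nB.
  exists (s ++ s'); split=> [k|r ur sr].
    by rewrite mem_cat negb_or qcoefD => /andP[/s0 -> /s0' ->]; rewrite addr0.
  have [sr1 sr2] : {subset s <= r} /\ {subset s' <= r}.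
    by split=> k ks; apply: sr; rewrite mem_cat ks ?orbT.
  apply: etrans (congr2 +%R (sE r ur sr1) (sE' r ur sr2)) _.
  rewrite -big_split; apply: eq_bigr => k _.
  by rewrite qcoefD rmorphD mulrDr.
- have -> : \pi_(Dprime K) (DMul u v) = \pi_(Dprime K) u * \pi_(Dprime K) v
    :> Dprime K by rewrite [RHS]dmul_pi.
  by rewrite -mulrA; apply: IHu; apply: IHv.
Qed.

Lemma qcoef_inj A B : qcoef A =1 qcoef B -> A = B.
Proof.
move=> AB; apply/eqP; rewrite -subr_eq0; apply/eqP.
have [s [_ /(_ (undup s) (undup_uniq s))->]] := has_normal_formP (A - B).
  by rewrite big1 // => k _; rewrite qcoefD qcoefN AB subrr rmorph0 mulr0.
by move=> k; rewrite mem_undup.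
Qed.

(** * Symbols: coefficients modulo left multiples of t *)

(* [A |-> (symbol k A)_k] is the quotient map onto the right module
   [D' / zdelta D'], which is free over K[z] on the powers of q. *)
Definition symbol k A : {poly K} := (qcoef A k).[- (k%:~R * 'X)].

Lemma symbolB k A B : symbol k (A - B) = symbol k A - symbol k B.
Proof. by rewrite /symbol qcoefD qcoefN !hornerE. Qed.

Lemma symbolD k A B : symbol k (A + B) = symbol k A + symbol k B.
Proof. by rewrite /symbol qcoefD !hornerE. Qed.

Lemma symbolZ k c A : symbol k (c *: A) = c *: symbol k A.
Proof. by rewrite /symbol qcoefZ !hornerE mul_polyC. Qed.

Lemma symboltM k A : symbol k (Dzdelta * A) = 0.
Proof. by rewrite /symbol qcoeftM !hornerE addNr mul0r. Qed.

Lemma symbolMt k A : symbol k (A * Dzdelta) = - (k%:~R * 'X) * symbol k A.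
Proof. by rewrite /symbol qcoefMt !hornerE. Qed.

Lemma symbolMz k A : symbol k (A * Dz) = 'X * symbol k A.
Proof. by rewrite -Dz_central /symbol qcoefzM !hornerE. Qed.

Lemma symbolMq k A : symbol k (A * Dq) = symbol (k - 1) A.
Proof.
rewrite /symbol qcoefMq horner_comp !hornerE intrB mulrBl mul1r opprB.
by rewrite [- _ + _]addrC.
Qed.

Lemma symbolMtX k A m :
  symbol k (A * Dzdelta ^+ m) = (- (k%:~R * 'X)) ^+ m * symbol k A.
Proof.
elim: m => [|m IH]; first by rewrite !expr0 mulr1 mul1r.
by rewrite exprSr mulrA symbolMt IH exprS mulrA.
Qed.

Lemma symbolMprod k A (r : seq nat) (c : nat) :
  symbol k (A * \prod_(nu <- r) (c%:R *: Dzdelta + nu%:R *: Dz)) =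
  (\prod_(nu <- r) ((nu%:Z - c%:Z * k)%:~R * 'X)) * symbol k A.
Proof.
elim: r A => [|nu r IH] A; first by rewrite !big_nil mulr1 mul1r.
rewrite !big_cons mulrA IH mulrDr -!scalerAr symbolD !symbolZ symbolMt symbolMz.
rewrite [in RHS]mulrAC [RHS]mulrC; congr (_ * _).
rewrite 2!scaler_nat -[_ *+ c]mulr_natl -[_ *+ nu]mulr_natl intrB intrM.
by rewrite 2!mulrBl !mulNr mulrN addrC !mulrA.
Qed.

Lemma symbol_supp A : exists N : nat, forall k, N%:Z <= k -> symbol k A = 0.
Proof.
have [s [s0 _]] := has_normal_formP A.
(* A member of [s] is at most the sum of all absolute values, so it lies below this bound. *)
exists (\sum_(i <- s) `|i|%N).+1 => k Nk; rewrite /symbol s0 ?horner0 //.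
apply/negP => ks; move: Nk; rewrite (big_rem k ks) /=; lia.
Qed.

(** A zero symbol makes t + k z divide p_k, and q^k (t + k z) = t q^k brings the factor to the far
    left. *)
Lemma symbol_eq0_factor A : (forall k, symbol k A = 0) -> exists B, A = Dzdelta * B.
Proof.
move=> A0; have [s [_ /(_ (undup s) (undup_uniq s)) sE]] := has_normal_formP A.
rewrite sE => [|k]; last by rewrite mem_undup.
elim: (undup s) => [|k r [B BE]]; first by exists 0; rewrite big_nil mulr0.
have /eqP/factor_theorem[p pE] := A0 k; rewrite big_cons BE pE.
exists (qpow k * poly_op p + B); rewrite [RHS]mulrDr; congr (_ + _).
rewrite mulrA zdelta_qpow mulrC rmorphM /= mulrA /shift_zdelta.
by rewrite polyCN opprK.
Qed.

(** On the coefficient of q^k, t acts by t + k z, which is monic and hence regular. *)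
Lemma zdelta_inj : injective (fun A => Dzdelta * A).
Proof.
move=> A B AB; apply: qcoef_inj => k; have := congr1 (fun P => qcoef P k) AB.
rewrite !qcoeftM; apply: monic_lreg.
by rewrite /shift_zdelta -[_%:P]opprK -polyCN monicXsubC.
Qed.

End Coefficients.

(** * Division by t modulo left multiples of rho *)

Section ReducedOperator.
Variables (K : numFieldType) (n a : nat).
Hypothesis a_gt0 : (0 < a)%N.
Notation rho := (reduced_op K n a).
Implicit Types A B : Dprime K.

(** Moving [c_top] past q turns a t into a t + a z, the missing factor nu = a. *)
Lemma c_top_reduced_op : c_top K a * rho = square_h K n a.
Proof.
have a0 : a%:R != 0 :> K by rewrite pnatr_eq0 -lt0n.
rewrite /c_top /square_h mulrBr -!scalerAl -scalerAr scalerA mulfV // scale1r.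
rewrite -exprS mulrA Dzdelta_q Dz_central -mulrDr -mulrA scalerAr; congr (_ - _ * _).
rewrite big_nat_recr //= scalerAl scalerDr.
set x := _ + a%:R *: Dz; apply: commr_prod => nu _.
(* The factors differ by multiples of the central z, so the new one commutes with all others. *)
have -> : a%:R *: Dzdelta + nu%:R *: Dz = x + (nu%:R - a%:R) *: Dz :> Dprime K.
  by rewrite scalerBl -addrA [_ *: _ + (_ - _)]addrC subrK.
by apply: commrD => //; rewrite /GRing.comm -scalerAl -scalerAr Dz_central.
Qed.

(* No factor of the product vanishes: [nu / a] is not an integer for
   [0 < nu < a]. *)
Lemma symbol_reduced_op_step A k :
  symbol k (A * rho) = 0 -> symbol k A = 0 -> symbol (k - 1) A = 0.
Proof.
rewrite mulrBr -scalerAr symbolB symbolZ symbolMtX => + A0.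
rewrite A0 mulr0 scaler0 sub0r mulrA symbolMprod symbolMq => /eqP.
rewrite oppr_eq0 mulf_eq0 prodf_seq_eq0 => /orP[/hasP[nu]|/eqP //].
rewrite mem_index_iota => /andP[nu0 nua] /=.
rewrite mulf_eq0 polyX_eq0 orbF -(rmorph_int (@polyC K)) polyC_eq0 intr_eq0.
rewrite subr_eq0 => /eqP E.
by exfalso; have [k0|k0] := lerP k 0; nia.
Qed.

Lemma zdelta_colon_reduced_op A B :
  Dzdelta * A = B * rho -> exists C, A = C * rho.
Proof.
move=> AB; have [N suppN] := symbol_supp B.
(* Descending induction on k = N - m, starting where the symbols of [B] already vanish. *)
have B0 (m : nat) : symbol (N%:Z - m%:Z) B = 0.
  elim: m => [|m IH]; first by apply: suppN; rewrite subr0.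
  rewrite -addn1 PoszD opprD addrA; apply: symbol_reduced_op_step => //.
  by rewrite -AB symboltM.
have [k|C BC] := symbol_eq0_factor (A := B).
  have [|kN] := lerP N%:Z k; first exact: suppN.
  by have := B0 `|N%:Z - k|%N; rewrite (_ : N%:Z - _ = k) //; lia.
by exists C; apply: zdelta_inj; rewrite /= AB BC mulrA.
Qed.

End ReducedOperator.

(** * Generated left ideals and the equality *)

(** The left multiples of [s] already form a left ideal containing [s]. *)
Lemma left_ideal_gen1 (D : nzRingType) (s x : D) :
  left_ideal_gen [set s] x -> exists y, x = y * s.
Proof.
move=> /(_ [set u | exists y, u = y * s]); apply; last first.
  by move=> _ ->; exists 1; rewrite mul1r.
split; first by exists 0; rewrite mul0r.
- by move=> _ _ [u ->] [v ->]; exists (u + v); rewrite mulrDl.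
- by move=> c _ [u ->]; exists (c * u); rewrite mulrA.
Qed.

Lemma left_ideal_genP (D : nzRingType) (S : set D) :
  is_left_ideal (left_ideal_gen S).
Proof.
split=> [I [] //|x y xS yS I II SI|c x xS I II SI]; have [_ ID IM] := II.
- by apply: ID; [apply: xS|apply: yS].
- by apply: IM; apply: xS.
Qed.

Theorem proposition6p3 (R : realType) (n a : nat)
    (hn : (1 <= n)%N) (ha : (1 <= a <= n.+1)%N) :
  left_colon (left_ideal_gen [set square_h R[i] n a]) (c_top R[i] a) =
  left_ideal_gen [set square_h R[i] n a; reduced_op R[i] n a].
Proof.
have /andP[a0 _] := ha.
have a0' : a%:R != 0 :> R[i] by rewrite pnatr_eq0 -lt0n.
have cE := c_top_reduced_op R[i] n a0.
(* Both sides are generated left ideals, so it suffices to treat generators of one in a left ideal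
   [I] containing those of the other. *)
apply/seteqP; split=> P PG I II SI; apply: PG => // Q.
- move=> /left_ideal_gen1[B]; rewrite -cE mulrA -scalerAl => QB.
  (* Dividing a t Q = B [c_top] rho by a gives the form t Q = B' rho. *)
  have [|C ->] := @zdelta_colon_reduced_op R[i] n a a0 Q
    (a%:R^-1 *: (B * c_top R[i] a)).
    by rewrite -scalerAl -QB scalerA mulVf // scale1r.
  by have [_ _ IM] := II; apply/IM/SI; right.
- have sG : left_ideal_gen [set square_h R[i] n a] (square_h R[i] n a).
    by move=> J _; apply.
  case=> ->; apply: SI; rewrite /= ?cE //.
  by have [_ _ GM] := left_ideal_genP [set square_h R[i] n a]; apply: GM.
Qed.
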